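(* Let $G$ be a nilpotent locally compact second countable (lcsc) group. Then every approximate lattice in $G$ is a uniform approximate lattice.
   Context: Approximate subgroup: a subset $\Lambda$ of a group $G$ which is symmetric ($\Lambda=\Lambda^{-1}$), contains the identity, and for which there is a finite set $F\subset\Lambda^\infty$ with $\Lambda^2\subset F\Lambda$, where $\Lambda^\infty$ is the subgroup of $G$ generated by $\Lambda$ and $\Lambda^2=\{xy: x,y\in\Lambda\}$. Let $d$ be any proper left-invariant metric on $G$ inducing its topology (the notions below do not depend on $d$). $\Lambda\subset G$ is uniformly discrete if there is $r>0$ with $d(x,y)\ge r$ for all distinct $x,y\in\Lambda$; relatively dense if there is $R>0$ such that every $g \in G$ satisfies $d(g,x)<R$ for some $x\in\Lambda$; a Delone set if it is non-empty and both uniformly discrete and relatively dense. A uniform approximate lattice in $G$ is an approximate subgroup which is a Delone set. Let $\mathcal C(G)$ be the compact space of closed subsets of $G$ with the Chabauty-Fell topology, generated by the sets $U_K=\{A: A\cap K=\emptyset\}$ ($K$ compact) and $U^V=\{A: A\cap V\ne\emptyset\}$ ($V$ open). $G$ acts on $\mathcal C(G)$ by $g.A=gA$. The (right-)hull of a closed $\Lambda\subset G$ is $X_\Lambda=\overline{G.\Lambda}\subset\mathcal C(G)$. A probability measure $\mu$ on $G$ is admissible if it is absolutely continuous with respect to the Haar measure class and its support generates $G$ as a semigroup. A probability measure $\nu$ on a compact $G$-space is $\mu$-stationary if $\mu*\nu=\nu$. An approximate lattice in $G$ is a uniformly discrete approximate subgroup $\Lambda\subset G$ such that for every admissible probability measure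 $\mu$ on $G$ there is a $\mu$-stationary probability measure $\nu$ on $X_\Lambda$ with $\nu(\{\emptyset\})=0$. *)

(* Defs.v *)
From HB Require Import structures.
From mathcomp Require Import all_boot all_order all_algebra.
From mathcomp Require Import all_classical all_reals all_analysis.

Set Implicit Arguments.
Unset Strict Implicit.
Unset Printing Implicit Defensive.

Import Order.TTheory GRing.Theory Num.Theory.

Local Open Scope classical_set_scope.
Local Open Scope group_scope.

HB.mixin Record isTopologicalGroup G & PointedTopological G & Group G := {
  mulg_continuous : continuous (fun x : G * G => x.1 * x.2) ;
  invg_continuous : continuous (fun x : G => x^-1)
}.

(* The distinguished point of PointedTopological plays no role: it is only
   there because the library equips a type with a generated sigma-algebra
   when the type is pointed. *)
#[short(type="topologicalGroupType")]
HB.structure Definition TopologicalGroup :=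
  {G of PointedTopological G & Group G & isTopologicalGroup G}.

Definition lcsc (G : topologicalGroupType) : Prop :=
  [/\ hausdorff_space G, locally_compact [set: G] & @second_countable G].

Section groups.
Context {G : groupType}.
Implicit Types (A S : set G).

Definition generated_subgroup S : set G :=
  smallest (fun H : set G => group_closed [in H]) S.

Definition generated_semigroup S : set G :=
  smallest (fun H : set G => mulg_closed [in H]) S.

Fixpoint lower_central (n : nat) : set G :=
  if n is m.+1 then
    generated_subgroup [set [~ x, y] | x in lower_central m & y in [set: G]]
  else [set: G].

Definition translate (g : G) A : set G := [set g * x | x in A].

Definition approximate_subgroup (L : set G) : Prop :=
  [/\ [set x^-1 | x in L] = L,
      L 1 &
      exists F : set G,
        [/\ finite_set F,
            F `<=` generated_subgroup L &
            [set x * y | x in L & y in L] `<=` [set f * y | f in F & y in L]]].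

End groups.

Definition nilpotent_group (G : groupType) : Prop :=
  exists n, @lower_central G n = [set 1].

Section metric.
Context {R : realType} {G : topologicalGroupType}.
Variable d : G -> G -> R.
Local Open Scope ring_scope.

Definition compatible_metric : Prop :=
  [/\ forall x y, d x y = 0 <-> x = y,
      forall x y, d x y = d y x,
      forall x y z, d x z <= d x y + d y z &
      forall (x : G) (U : set G), nbhs x U <->
        exists2 e : R, 0 < e & [set y | d x y < e] `<=` U].

Definition left_invariant_metric : Prop :=
  forall g x y : G, d (g * x)%g (g * y)%g = d x y.

Definition proper_metric : Prop :=
  forall (x : G) (r : R), compact [set y | d x y <= r].

Definition uniformly_discrete (L : set G) : Prop :=
  exists2 r : R, 0 < r & forall x y, L x -> L y -> x <> y -> r <= d x y.

Definition relatively_dense (L : set G) : Prop :=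
  exists2 r : R, 0 < r & forall g, exists2 x, L x & d g x < r.

Definition delone (L : set G) : Prop :=
  [/\ L !=set0, uniformly_discrete L & relatively_dense L].

Definition uniform_approximate_lattice (L : set G) : Prop :=
  approximate_subgroup L /\ delone L.

End metric.

Record closed_subset (T : topologicalType) := ClosedSubset {
  carrier :> set T ;
  closed_carrier : closed carrier
}.

Section chabauty_fell.
Variable T : topologicalType.

HB.instance Definition _ := gen_eqMixin (closed_subset T).
HB.instance Definition _ := gen_choiceMixin (closed_subset T).

Definition closed_empty : closed_subset T := ClosedSubset (@closed0 T).

HB.instance Definition _ := isPointed.Build (closed_subset T) closed_empty.

Definition chabauty_subbase : set (set (closed_subset T)) :=
  [set [set A : closed_subset T | A `&` K = set0] | K in @compact T] `|`
  [set [set A : closed_subset T | A `&` V !=set0] | V in @open T].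

HB.instance Definition _ :=
  isSubBaseTopological.Build (closed_subset T) chabauty_subbase id.

End chabauty_fell.

Section action.
Context {G : topologicalGroupType}.

Lemma closed_translate (g : G) (A : set G) : closed A -> closed (translate g A).
Proof.
move=> cA; have -> : translate g A = (fun x => g^-1 * x) @^-1` A.
  apply/seteqP; split => [_ [x Ax <-]|x Ax] /=; first by rewrite mulKg.
  by exists (g^-1 * x) => //; rewrite mulVKg.
apply: preimage_closed => // x _.
have pair_cvg : (fun y : G => (g^-1, y)) @ x --> (g^-1, x).
  by apply: cvg_pair => /=; [exact: cvg_cst|exact: cvg_id].
exact: (continuous_comp pair_cvg (@mulg_continuous G (g^-1, x))).
Qed.

Definition act (g : G) (A : closed_subset G) : closed_subset G :=
  ClosedSubset (closed_translate (g := g) (closed_carrier (c := A))).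

(* Defined for an arbitrary set L so as not to carry a closedness proof around:
   the orbit of L is made of those closed sets that are translates of L.
   Uniformly discrete sets are closed. *)
Definition hull (L : set G) : set (closed_subset G) :=
  closure [set A | exists g : G, carrier A = translate g L].

End action.

Definition borel (T : ptopologicalType) := g_sigma_algebraType (@open T).

HB.instance Definition _ (T : ptopologicalType) := Measurable.on (borel T).

Section measures.
Context {R : realType} {G : topologicalGroupType}.
Local Open Scope ring_scope.
Local Open Scope ereal_scope.

(* Regularity of m is automatic on an lcsc group. *)
Definition haar_measure (m : {measure set (borel G) -> \bar R}) : Prop :=
  [/\ m setT != 0,
      forall K : set G, compact K -> m K < +oo &
      forall (g : G) (E : set (borel G)), measurable E ->
        m (translate g E) = m E].

Definition measure_support (mu : set (borel G) -> \bar R) : set G :=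
  [set x : G | forall U : set G, open U -> U x -> 0 < mu U].

Definition admissible (mu : probability (borel G) R) : Prop :=
  (exists2 m : {measure set (borel G) -> \bar R},
     haar_measure m & mu `<< m) /\
  generated_semigroup (measure_support mu) = [set: G].

(* The convolution mu * nu is the image of the product measure under the
   action map. *)
Definition stationary (mu : probability (borel G) R)
    (nu : probability (borel (closed_subset G)) R) : Prop :=
  forall E : set (borel (closed_subset G)), measurable E ->
    pushforward (mu \x nu)
      (fun p : borel G * borel (closed_subset G) =>
         act p.1 p.2 : borel (closed_subset G)) E = nu E.

(* A probability measure on the hull of L is encoded as one on the ambient
   space of closed subsets that gives full mass to the (closed) hull. *)
Definition approximate_lattice (d : G -> G -> R) (L : set G) : Prop :=
  [/\ approximate_subgroup L,
      uniformly_discrete d L &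
      forall mu : probability (borel G) R, admissible mu ->
        exists nu : probability (borel (closed_subset G)) R,
          [/\ nu (hull L) = 1, stationary mu nu &
              nu [set closed_empty G] = 0]].

End measures.

(* Main.v *)
From HB Require Import structures.
From mathcomp Require Import all_boot all_order all_algebra.
From mathcomp Require Import all_classical all_reals all_analysis.
From mathcomp Require Import measurable_realfun.
From mathcomp Require Import zify ring lra.
Require Import Defs.

(* Let [mu] be a probability measure equivalent to a Haar measure and [nu] a
   [mu]-stationary measure on the hull with [nu {empty} = 0]. For [W] open,
   [g |-> nu {A | g A meets W}] is a bounded [mu]-harmonic function, hence
   constant since [G] is nilpotent (Choquet-Deny). For a large ball [W] the
   sets [{A | A meets g W}] therefore all have the same positive [nu]-measure,
   so only finitely many of them can be pairwise disjoint on the hull: there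
   are [g_1, ..., g_n] with [G] the union of the [g_i W L^-1 L W^-1]. Thus
   [G = K L^2 K] with [K] bounded, and commuting [K] past the elements of the
   lower central series, from its last term upwards, gives [G = L K'].
   A Haar measure is obtained from the invariant proper metric, as the
   ultralimit at small scales of ratios of covering numbers. *)

Set Implicit Arguments.
Unset Strict Implicit.
Unset Printing Implicit Defensive.

Import Order.TTheory GRing.Theory Num.Theory.
Import numFieldNormedType.Exports.

Local Open Scope classical_set_scope.
Local Open Scope group_scope.

(** * The lower central series and relative density *)

Section lower_central_series.
Context {G : groupType}.

Lemma group_closed_setP (S : set G) :
  group_closed [in S] <-> S 1 /\ forall x y, S x -> S y -> S (x / y).
Proof.
split=> -[S1 SB]; split.
- by move: S1; rewrite !inE.
- by move=> x y Sx Sy; have := SB x y; rewrite !inE; apply.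
- by rewrite !inE.
- by move=> x y; rewrite !inE; exact: SB.
Qed.

Lemma lower_central_group (n : nat) :
  @lower_central G n 1 /\
  forall x y, @lower_central G n x -> lower_central n y -> lower_central n (x / y).
Proof.
case: n => [//|n]; split => [H [/group_closed_setP[]]//|x y nx ny H HH].
by have [/group_closed_setP[_ +] _] := HH; apply; [exact: nx|exact: ny].
Qed.

Lemma lower_centralV (n : nat) (x : G) :
  lower_central n x -> lower_central n x^-1.
Proof.
by have [n1 nB] := lower_central_group n; rewrite -div1g; exact: nB.
Qed.

Lemma lower_centralR (n : nat) (x y : G) :
  lower_central n x -> lower_central n.+1 [~ x, y].
Proof. by move=> nx; apply: sub_gen_smallest; exists x => //; exists y. Qed.

(** Normality of the terms: by induction a conjugate of a generating commutator is again one, so the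
    subgroup [N] contains all generators. *)
Lemma lower_centralJ (n : nat) (x g : G) :
  lower_central n x -> lower_central n (x ^ g).
Proof.
elim: n x g => [//|n IHn] x g.
pose N := [set y : G | lower_central n.+1 (y ^ g)].
suff : lower_central n.+1 `<=` N by apply.
have [H1 Hdiv] := lower_central_group n.+1.
apply: smallest_sub; last first.
  move=> _ [u nu [v _ <-]]; rewrite /N/= conjRg.
  by apply: lower_centralR; exact: IHn.
apply/group_closed_setP; split=> [|u v nu nv]; first by rewrite /N/= conj1g.
by rewrite /N/= conjMg conjVg; exact: Hdiv.
Qed.

End lower_central_series.

Section left_invariant_metrics.
Context {R : realType} {G : topologicalGroupType} {d : G -> G -> R}.
Context (d_compat : compatible_metric d) (d_linv : left_invariant_metric d).
Local Open Scope ring_scope.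

Lemma metric_refl x : d x x = 0.
Proof. by case: d_compat => + _ _ _; move=> /(_ x x) [_]; apply. Qed.

Lemma metric_sym x y : d x y = d y x.
Proof. by case: d_compat. Qed.

Lemma metric_triangle y x z : d x z <= d x y + d y z.
Proof. by case: d_compat. Qed.

Lemma metric_ge0 x y : 0 <= d x y.
Proof.
have := metric_triangle y x x; rewrite metric_refl (metric_sym y x); lra.
Qed.

Lemma metric_mulgr x y : d x (x * y)%g = d 1%g y.
Proof. by rewrite -{1}(mulg1 x) d_linv. Qed.

Lemma metric1M x y : d 1%g (x * y)%g <= d 1%g x + d 1%g y.
Proof. by rewrite -(metric_mulgr x y); exact: metric_triangle. Qed.

Lemma metric1V x : d 1%g (x^-1)%g = d 1%g x.
Proof. by rewrite -(d_linv x) mulg1 mulgV metric_sym. Qed.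

(* Turns [L^2 `<=` F L] into the statement that [L^2] lies at bounded distance
   from [L], which needs the inverse of the inclusion, [L^2 `<=` L F^-1]. *)
Lemma approximate_subgroup_sq_near (L : set G) : approximate_subgroup L ->
  exists r : R, forall x y, L x -> L y -> exists2 l, L l & d (x * y)%g l < r.
Proof.
move=> [LV _ [F [Ffin _ LF]]].
have {}LV x : L x -> L (x^-1)%g by move=> Lx; rewrite -LV; exists x.
have [r rF] : exists r, forall f, F f -> d 1%g f < r.
  have /finite_seqP [s ->] := Ffin.
  exists (\sum_(f <- s) d 1%g f + 1) => f /= fs.
  rewrite (big_rem f) //=.
  have : 0 <= \sum_(i <- rem f s) d 1%g i.
    by apply: sumr_ge0 => i _; exact: metric_ge0.
  lra.
exists r => x y Lx Ly.
have [f Ff [l Ll E]] : [set f * l | f in F & l in L]%g ((y^-1 * x^-1)%g).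
  by apply: LF; exists (y^-1)%g; [exact: LV|exists (x^-1)%g; [exact: LV|]].
exists (l^-1)%g; first exact: LV.
have -> : (x * y = l^-1 * f^-1)%g by rewrite -invgM E invgM !invgK.
by rewrite metric_sym metric_mulgr metric1V; exact: rF.
Qed.

(* Descending the lower central series: for [z] in a term of the series write
   [z = k * x * y * k']; commuting [k] past [z] costs an element of the next
   term, which is normal and already lies at bounded distance from [L]. *)
Lemma nilpotent_relatively_dense (L : set G) (r : R) :
  nilpotent_group G -> approximate_subgroup L ->
  (forall g : G, exists k x y k', [/\ d 1%g k < r, d 1%g k' < r, L x, L y
     & g = k * x * y * k']%g) ->
  relatively_dense d L.
Proof.
move=> [n nilG] Lapp Lr.
have [s Ls] := approximate_subgroup_sq_near Lapp.
have L1 : L 1%g by case: Lapp.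
(* Induction from the last term, [i = 0], up to the whole group, [i = n]. Subtraction is truncated,
   so nothing changes once [i] has reached [n]. *)
suff H i : exists2 t : R, 0 < t &
    forall g : G, lower_central (n - i) g -> exists2 x, L x & d g x < t.
  by have [t t0 Ht] := H n; exists t => // g; apply: Ht; rewrite subnn.
elim: i => [|i [t t0 IH]].
  exists 1 => // g; rewrite subn0 nilG => ->; exists 1%g => //.
  by rewrite metric_refl.
have [ni|ni] := ltnP i n; last first.
  by exists t => // g; have -> : (n - i.+1 = n - i)%N; [lia|exact: IH].
have [r0 r00 [rr0 sr0]] : exists2 r0 : R, 0 < r0 & r <= r0 /\ s <= r0.
  exists (1 + `|r| + `|s|); first by have := normr_ge0 r; have := normr_ge0 s; lra.
  by have := ler_norm r; have := ler_norm s; have := normr_ge0 r;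
     have := normr_ge0 s; lra.
(* The chain [z], [x y c'], [x y l], [x l1], [l2] has steps below [2 r0], [t], [s], [s], and
   [s <= r0]. *)
exists (t + 4 * r0) => [|z zi]; first lra.
have [k [x [y [k' [kr k'r Lx Ly E]]]]] := Lr z.
pose c := ([~ z, k])%g.
have ci : lower_central (n - i) c.
  by have -> : (n - i = (n - i.+1).+1)%N; [lia|exact: lower_centralR].
have Exy : (x * y = z * c * (k^-1 * k'^-1))%g.
  rewrite /c commgEl conjgE !mulgA mulgV mul1g {1}E.
  by rewrite !mulgA !(mulgK, mulgVK, mulVg, mul1g).
pose q := (k^-1 * k'^-1)%g.
pose c' := (c^-1 ^ q)%g.
(* Up to the short right factor [q^-1], the error is [c'], a conjugate of [c^-1]; it lies in the
   next term, hence near [L] by induction. *)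
have Ez : (z = x * y * c' * q^-1)%g.
  by rewrite /c' conjgE Exy -/q; move: (c) (q) => ? ?; rewrite !mulgA !mulgK.
have [l Ll dl] : exists2 l, L l & d c' l < t.
  by apply: IH; apply: lower_centralJ; exact: lower_centralV.
have [l1 Ll1 dl1] := Ls _ _ Ly Ll.
have [l2 Ll2 dl2] := Ls _ _ Lx Ll1.
exists l2 => //.
have h1 : d z (x * y * c')%g < 2 * r0.
  rewrite {1}Ez metric_sym metric_mulgr metric1V.
  by have := metric1M (k^-1)%g (k'^-1)%g; rewrite !metric1V -/q; lra.
have h2 : d (x * y * c')%g (x * y * l)%g < t by rewrite d_linv.
have h3 : d (x * y * l)%g (x * l1)%g < s by rewrite -mulgA d_linv.
have := metric_triangle (x * y * c')%g z l2.
have := metric_triangle (x * y * l)%g (x * y * c')%g l2.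
have := metric_triangle (x * l1)%g (x * y * l)%g l2.
lra.
Qed.

End left_invariant_metrics.

(** * Harmonic functions on nilpotent groups *)

Section borel_translations.
Context {G : topologicalGroupType}.

Lemma mulgl_continuous (g : G) : continuous (fun x : G => g * x).
Proof.
move=> x; have gx : (fun y : G => (g, y)) @ x --> (g, x).
  by apply: cvg_pair => /=; [exact: cvg_cst|exact: cvg_id].
exact: (continuous_comp gx (@mulg_continuous G (g, x))).
Qed.

Lemma translateE (g : G) (A : set G) : translate g A = (fun x => g^-1 * x) @^-1` A.
Proof.
apply/seteqP; split => [_ [x Ax <-]|x Ax] /=; first by rewrite mulKg.
by exists (g^-1 * x) => //; rewrite mulVKg.
Qed.

Lemma open_translate (g : G) (A : set G) : open A -> open (translate g A).
Proof.
by move=> Ao; rewrite translateE; apply: open_comp => // x _; exact: mulgl_continuous.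
Qed.

Lemma measurable_open (T : ptopologicalType) (A : set (borel T)) :
  open (A : set T) -> measurable A.
Proof. by move=> Ao; exact: sub_gen_smallest. Qed.

Lemma measurable_mulgl (g : G) :
  measurable_fun [set: borel G] (fun x : borel G => (g * x)%g : borel G).
Proof.
apply: (@measurability _ _ (borel G) (borel G) _ _ (@open G)) => // _ [B Bo <-].
rewrite setTI; apply: measurable_open.
by apply: open_comp => // x _; exact: mulgl_continuous.
Qed.

Lemma measurable_translate (g : G) (A : set (borel G)) :
  measurable A -> measurable (translate g A : set (borel G)).
Proof.
by move=> mA; rewrite translateE -[X in measurable X]setTI; exact: measurable_mulgl.
Qed.

End borel_translations.

Section choquet_deny.
Context {R : realType} {G : topologicalGroupType} (mu : probability (borel G) R).
Local Open Scope ring_scope.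
Local Open Scope ereal_scope.

Definition quasi_invariant : Prop := forall (g : G) (A : set (borel G)),
  measurable A -> mu A = 0 -> mu (translate g A) = 0.

Definition harmonic (f : G -> R) : Prop :=
  forall g : G, \int[mu]_x (f (g * x)%g)%:E = (f g)%:E.

Context (mu_quasi : quasi_invariant).
Context (f : G -> R) (f_ge0 : forall x, (0 <= f x)%R) (f_le1 : forall x, (f x <= 1)%R).
Context (mf : measurable_fun [set: borel G] (f : borel G -> R)).
Context (f_harm : harmonic f).

Let mfl g : measurable_fun [set: borel G] (fun x : borel G => (f (g * x)%g)%:E).
Proof.
by apply/measurable_EFinP; apply: (measurableT_comp mf); exact: measurable_mulgl.
Qed.

(* By harmonicity the defect [M - (f (z g x) - f (g x))] has mean
   [M - (f (z g) - f g)], which is summable along [g_ n]; so by Borel-Cantelli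
   almost every [x] is eventually good, and by quasi-invariance almost every
   [x] is so together with all its translates [h x]. *)
Let almost_maximizer (z : G) (M : R) (g_ : nat -> G) : (0 < M)%R ->
  (forall g, f (z * g)%g - f g <= M)%R ->
  (forall n, M - M / 2 / (2 ^ n.+1)%:R <= f (z * g_ n)%g - f (g_ n))%R ->
  forall h : nat -> G, exists x, forall j, \forall n \near \oo,
    (M / 2 < f (z * (g_ n * (h j * x)))%g - f (g_ n * (h j * x))%g)%R.
Proof.
move=> M0 fM g_M h.
pose u n x := (M - (f (z * (g_ n * x))%g - f (g_ n * x)%g))%R.
have u0 n x : (0 <= u n x)%R by rewrite /u subr_ge0 fM.
have mu_ n : measurable_fun [set: borel G] (fun x : borel G => (u n x)%:E).
  apply/measurable_EFinP; apply: measurable_funB => //.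
  apply: measurable_funB; last by apply/measurable_EFinP; exact: mfl.
  under eq_fun do rewrite mulgA.
  by apply/measurable_EFinP; exact: mfl.
have int_u n : \int[mu]_x (u n x)%:E <= (M / 2 / (2 ^ n.+1)%:R)%:E.
  (* Both sides are sums of nonnegative functions, so they integrate termwise without subtracting
     integrals; harmonicity then evaluates the integrals of [f]. *)
  have : \int[mu]_x ((u n x)%:E + (f (z * g_ n * x)%g)%:E) =
         \int[mu]_x (M%:E + (f (g_ n * x)%g)%:E).
    by apply: eq_integral => x _; rewrite -!EFinD /u mulgA; congr EFin; ring.
  rewrite !ge0_integralD //; try by move=> x _; rewrite lee_fin.
  2: by move=> x _; rewrite lee_fin ltW.
  rewrite !f_harm integral_cst// [X in M%:E * X](probability_setT mu) mule1 -EFinD.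
  have := g_M n.
  case: (\int[mu]_x (u n x)%:E) => //= r H /(congr1 fine) /= E.
  rewrite lee_fin; lra.
pose B n : set (borel G) := [set x | (M / 2)%:E <= (u n x)%:E].
have mB n : measurable (B n).
  rewrite -[B n]setTI; exact: emeasurable_fun_c_infty.
(* Markov's inequality at the threshold [M / 2], which cancels the factor [M / 2] in [int_u]. *)
have muB n : mu (B n) <= (1 / (2 ^ n.+1)%:R)%:E.
  have M20 : (0 < M / 2)%R by lra.
  have := @le_integral_comp_abse _ _ _ mu _ measurableT _ (M / 2)%R id
    (@measurable_id _ _ setT) (fun _ r0 => r0) (fun _ _ _ _ xy => xy) (mu_ n) M20.
  have -> : [set: borel G] `&` [set x : borel G | (M / 2)%:E <= `|(u n x)%:E|] = B n.
    by rewrite setTI; apply/funext => x; rewrite /B /= ger0_norm.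
  rewrite (eq_integral (fun x : borel G => (u n x)%:E)); last first.
    by move=> x _ /=; rewrite ger0_norm.
  move=> /le_trans /(_ (int_u n)).
  rewrite -lee_pdivlMl// => /le_trans; apply; rewrite -EFinM lee_fin.
  by rewrite mulrA mulVf ?gt_eqF.
pose N := lim_sup_set B.
have N0 : mu N = 0.
  apply: lim_sup_set_cvg0 => //.
  apply: (@le_lt_trans _ _ (\sum_(n <oo) (1 / (2 ^ n.+1)%:R)%:E)).
    by apply: lee_nneseries => n *; [exact: measure_ge0|exact: muB].
  by apply: (le_lt_trans (epsilon_trick0 _ _)); rewrite ?ltry.
have mN : measurable N.
  by apply: bigcap_measurable => // k _; apply: bigcup_measurable.
pose N' := \bigcup_j (translate (h j)^-1%g N : set (borel G)).
have mN' : measurable N'.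
  by apply: bigcup_measurable => j _; exact: measurable_translate.
have N'0 : mu N' = 0.
  apply/eqP; rewrite -measure_le0.
  apply: (le_trans (generalized_Boole_inequality mu _ mN')).
    by move=> j; exact: measurable_translate.
  by rewrite eseries0 // => j _ _; exact: mu_quasi.
have [x N'x] : exists x, ~ N' x.
  apply/existsNP => H; have : mu [set: borel G] = 0.
    by rewrite -N'0; congr (mu _); apply/seteqP; split.
  by rewrite [LHS](probability_setT mu) => /eqP; rewrite onee_eq0.
exists x => j.
have : ~ N (h j * x)%g.
  by move=> Nx; apply: N'x; exists j => //; rewrite translateE /= invgK.
move=> /existsNP [n] /not_implyP [_ Hn].
exists n => // m /= nm; rewrite ltNge; apply/negP => H.
apply: Hn; exists m => //; rewrite /B /= lee_fin /u; lra.
Qed.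

(** Since [f] does not see commutators of [z], it takes the same value at [z g_n z^j x] and
    [g_n z^(j+1) x]. Were the supremum of [f (z g) - f g] positive, [f] would climb by more than
    half of it at each step along the points [g_n z^j x] and finally exceed 1. *)
Let central_le (i : nat) (z : G) :
  (forall u g, lower_central i.+1 u -> f (u * g)%g = f g) ->
  lower_central i z -> forall g, (f (z * g)%g <= f g)%R.
Proof.
move=> f_inv iz.
pose D := [set (f (z * g)%g - f g)%R | g in [set: G]].
have Dub : ubound D 1%R.
  by move=> _ [g _ <-]; have := f_le1 (z * g)%g; have := f_ge0 g; lra.
have Dsup : has_sup D by split; [exists (f (z * 1)%g - f 1%g)%R, 1%g|exists 1%R].
have fM g : (f (z * g)%g - f g <= sup D)%R by apply: sup_upper_bound => //; exists g.
have [M0 g|M0] := leP (sup D) 0%R; first by have := fM g; lra.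
have /choice [g_ g_M] : forall n, exists g,
    (sup D - sup D / 2 / (2 ^ n.+1)%:R <= f (z * g)%g - f g)%R.
  move=> n; have e0 : (0 < sup D / 2 / (2 ^ n.+1)%:R)%R.
    by rewrite divr_gt0 ?ltr0n ?expn_gt0// divr_gt0.
  by have [_ [g _ <-] /ltW] := sup_adherent e0 Dsup; exists g.
have [x Hx] := almost_maximizer M0 fM g_M (fun j => z ^+ j)%g.
have step n j : (f (z * (g_ n * (z ^+ j * x)))%g = f (g_ n * (z ^+ j.+1 * x))%g)%R.
  rewrite mulgA (commgCV z) -mulgA f_inv; last first.
    by apply: lower_centralR; exact: lower_centralV.
  by rewrite [in RHS]expgS !mulgA.
(* Enough steps of height [sup D / 2] to exceed 1; being finitely many, they are all available for
   one common [n]. *)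
pose N := Num.truncn (2 / sup D).
have N2 : (1 < N.+1%:R * (sup D / 2))%R.
  rewrite mulrA ltr_pdivlMr// mul1r -ltr_pdivrMr//.
  by rewrite truncnS_gt.
have : \forall n \near \oo, forall j, (j < N.+1)%N ->
    (sup D / 2 < f (z * (g_ n * (z ^+ j * x)))%g - f (g_ n * (z ^+ j * x))%g)%R.
  elim: (N.+1) => [|k IHk]; first by near=> n.
  near=> n => j; rewrite ltnS leq_eqVlt => /orP[/eqP ->|].
    by near: n; exact: Hx.
  by move: j; near: n.
move=> [n _ /(_ n (leqnn n)) Hn].
suff : (N.+1%:R * (sup D / 2) <= f (g_ n * (z ^+ N.+1 * x))%g - f (g_ n * x)%g)%R.
  by have := f_le1 (g_ n * (z ^+ N.+1 * x))%g; have := f_ge0 (g_ n * x)%g; lra.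
elim: (N.+1) Hn => [|k IHk] Hk; first by rewrite expg0 mul1g mul0r subrr.
have /IHk {}IHk : forall j, (j < k)%N -> 
   (sup D / 2 < f (z * (g_ n * (z ^+ j * x)))%g - f (g_ n * (z ^+ j * x))%g)%R.
  by move=> j jk; apply: Hk; exact: ltnW.
have := Hk k (leqnn _); rewrite step -[k.+1%:R]natr1 mulrDl mul1r; lra.
Unshelve. all: by end_near. Qed.

(** Invariance under the terms of the lower central series is obtained from the last one upwards:
    [central_le] for [u] and for [u^-1] gives the two inequalities. The term of index 0 is [G]
    itself. *)
Lemma harmonic_nilpotent_constant : nilpotent_group G -> forall x, f x = f 1%g.
Proof.
move=> [n nilG].
suff H i : forall u g, lower_central (n - i) u -> f (u * g)%g = f g.
  by move=> x; rewrite -[x in LHS]mulg1 (H n)// subnn.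
elim: i => [u g|i IHi u g]; first by rewrite subn0 nilG => ->; rewrite mul1g.
have [ni|ni] := ltnP i n; last first.
  by have -> : (n - i.+1 = n - i)%N; [lia|exact: IHi].
move=> iu; have f_inv v h : lower_central (n - i.+1).+1 v -> f (v * h)%g = f h.
  by have -> : ((n - i.+1).+1 = n - i)%N; [lia|exact: IHi].
apply/eqP; rewrite eq_le (central_le f_inv)//=.
have := central_le f_inv (lower_centralV iu) (u * g)%g.
by rewrite mulKg.
Qed.

End choquet_deny.

(** * Recurrence on the hull *)

Section hitting_sets.
Context {G : topologicalGroupType}.

Definition hitting (W : set G) : set (closed_subset G) :=
  [set A | A `&` W !=set0].

Lemma open_hitting (W : set G) : open W -> open (hitting W).
Proof.
move=> Wo; exists [set hitting W]; last by rewrite bigcup_set1.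
by move=> _ ->; apply: (@finI_from1 _ _ _ id); right; exists W.
Qed.

Lemma measurable_hitting (W : set G) :
  open W -> measurable (hitting W : set (borel (closed_subset G))).
Proof. by move=> Wo; apply: measurable_open; exact: open_hitting. Qed.

Lemma hitting_act (g : G) (A : closed_subset G) (W : set G) :
  hitting W (act g A) <-> hitting (translate g^-1 W) A.
Proof.
split=> [[y [[x Ax gx] Wy]]|[y [Ay [w Ww gw]]]].
  by exists x; split => //; rewrite translateE /= invgK gx.
by exists w; split => //; exists y => //; rewrite -gw mulVKg.
Qed.

Lemma translateM (g h : G) (W : set G) :
  translate g (translate h W) = translate (g * h) W.
Proof.
by rewrite !translateE; apply/funext => x /=; rewrite invgM mulgA.
Qed.

(** Measurability is for the product sigma-algebra, so openness would not be enough. By continuity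
    of multiplication the set is a union of rectangles [U x hitting V] with [U V] inside [W], and
    [U], [V] may be taken in a countable base. *)
Lemma measurable_act_hitting (W : set G) : @second_countable G -> open W ->
  measurable [set p : borel G * borel (closed_subset G) | hitting W (act p.1 p.2)].
Proof.
move=> [B Bcount [Bopen Bbasis]] Wo.
pose D := [set UV : set G * set G | [/\ B UV.1, B UV.2 &
  forall u v, UV.1 u -> UV.2 v -> W (u * v)]].
have Dcount : countable D.
  apply: (@sub_countable _ _ _ (B `*` B)); last exact: countableX.
  by apply: subset_card_le => -[U V] [].
rewrite [X in measurable X](_ : _ = \bigcup_(UV in D)
    ((UV.1 : set (borel G)) `*` (hitting UV.2 : set (borel (closed_subset G))))).
  rewrite bigcup_set_type; apply: countable_bigcupT_measurable.
    by rewrite (eq_countable (card_setT _)).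
  move=> -[[U V] /= UVD]; have [BU BV _] := set_mem UVD.
  apply: measurableX; first by apply: measurable_open; exact: Bopen.
  by apply: measurable_hitting; exact: Bopen.
apply/seteqP; split => [[g A]|[g A] [[U V] /= [_ _ UVW]] [Ug [x [Ax Vx]]]]; last first.
  by exists (g * x); split; [exists x|exact: UVW].
move=> /= [y [[x Ax gx] Wgx]]; rewrite -{}gx in Wgx.
have [[P Q] /= [Pg Qx] PQ] : nbhs (g, x) [set p : G * G | W (p.1 * p.2)].
  apply: (@mulg_continuous G (g, x)); exact: open_nbhs_nbhs.
have [U [BU Ug] UP] := Bbasis _ _ Pg.
have [V [BV Vx] VQ] := Bbasis _ _ Qx.
exists (U, V); last by split => //; exists x.
by split => //= u v Uu Vv; apply: (PQ (u, v)); split; [exact: UP|exact: VQ].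
Qed.

End hitting_sets.

Section stationary_hitting.
Context {R : realType} {G : topologicalGroupType}.
Context (mu : probability (borel G) R) (nu : probability (borel (closed_subset G)) R).
Context (G2 : @second_countable G) (nu_stat : stationary mu nu).
Local Open Scope ring_scope.
Local Open Scope ereal_scope.

(** By [hitting_act] this is the [nu]-measure of the closed sets [A] such that [g A] meets [W]. *)
Let F (W : set G) (g : G) : R := fine (nu (hitting (translate (g^-1)%g W))).

Let FE (W : set G) g : open W -> (F W g)%:E = nu (hitting (translate (g^-1)%g W)).
Proof.
move=> Wo; rewrite /F fineK//; apply: fin_num_measure.
by apply: measurable_hitting; exact: open_translate.
Qed.

Let xsection_act (W : set G) (g : G) :
  xsection [set p : borel G * borel (closed_subset G) | hitting W (act p.1 p.2)] g =
  hitting (translate (g^-1)%g W).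
Proof.
apply/seteqP; split => A; rewrite /xsection /= in_setE /=.
  by move=> /hitting_act.
by move=> ?; exact/hitting_act.
Qed.

(** Stationarity on the hitting sets of translates of [W], with the product measure computed by
    sections, says that [F W] is harmonic, hence constant. *)
Lemma hitting_constant (W : set G) : quasi_invariant mu -> nilpotent_group G ->
  open W -> forall g, nu (hitting (translate g W)) = nu (hitting W).
Proof.
move=> mu_quasi nilG Wo g.
have F0 x : (0 <= F W x)%R by rewrite fine_ge0.
have F1 x : (F W x <= 1)%R.
  by rewrite -lee_fin FE//; apply: probability_le1; apply: measurable_hitting;
    exact: open_translate.
have mF : measurable_fun [set: borel G] (F W : borel G -> R).
  apply/measurable_EFinP; rewrite (_ : _ \o _ = nu \o xsection
      [set p : borel G * borel (closed_subset G) | hitting W (act p.1 p.2)]).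
    apply: measurable_fun_xsection.
    exact: measurable_act_hitting.
  by apply/funext => x /=; rewrite FE// xsection_act.
have F_harm : harmonic mu (F W).
  move=> h; rewrite FE//.
  rewrite -nu_stat; last by apply: measurable_hitting; exact: open_translate.
  rewrite /pushforward /product_measure1; apply: eq_integral => x _.
  by rewrite FE// /= xsection_act translateM invgM.
have E := harmonic_nilpotent_constant mu_quasi F0 F1 mF F_harm nilG (g^-1)%g.
have := congr1 EFin E; rewrite !FE// invgK => ->.
congr (nu (hitting _)); rewrite translateE; apply/funext => x /=.
by rewrite !invg1 mul1g.
Qed.

End stationary_hitting.

Lemma open_metric_ball (R : realType) (G : topologicalGroupType) (d : G -> G -> R)
  (x : G) (r : R) : compatible_metric d -> open [set y | (d x y < r)%R].
Proof.
move=> [_ _ dtri dnbhs]; rewrite openE => y /= xy; apply/dnbhs.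
exists (r - d x y)%R; first by rewrite subr_gt0.
by move=> z /= yz; have := dtri x y z; lra.
Qed.

Section hull_recurrence.
Context {R : realType} {G : topologicalGroupType} (L : set G).
Context (nu : probability (borel (closed_subset G)) R).
Local Open Scope ring_scope.
Local Open Scope ereal_scope.

Let measurable_hull : measurable (hull L : set (borel (closed_subset G))).
Proof.
rewrite -[X in measurable X]setCK; apply: measurableC; apply: measurable_open.
by apply: closed_openC; exact: closed_closure.
Qed.

Definition hit_by_translate (U V : set G) : Prop :=
  exists g : G, (translate g L `&` U !=set0) /\ (translate g L `&` V !=set0).

(** Meeting both [U] and [V] is an open condition on closed sets, so once a point of the closure
    satisfies it, a point of the orbit does. *)
Lemma hull_hitting (U V : set G) (A : closed_subset G) : open U -> open V ->
  hull L A -> hitting U A -> hitting V A -> hit_by_translate U V.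
Proof.
move=> Uo Vo LA UA VA.
have : nbhs A (hitting U `&` hitting V).
  by apply: open_nbhs_nbhs; split => //; apply: openI; exact: open_hitting.
by move=> /LA [B [[g Bg] [UB VB]]]; exists g; rewrite -Bg.
Qed.

(* Translates of [hitting W] have a common positive measure, so only finitely
   many of them can be pairwise disjoint on the hull. *)
Lemma hull_recurrence (W : set G) : nu (hull L) = 1 -> open W ->
  0 < nu (hitting W) ->
  (forall g, nu (hitting (translate g W)) = nu (hitting W)) ->
  exists s : seq G, forall g, exists2 a, a \in s &
    hit_by_translate (translate a W) (translate g W).
Proof.
move=> hull1 Wo W0 W_inv; apply: contrapT => /forallNP no_s.
(* Any list [s] can be extended by [g_ s], whose hitting set is disjoint, on the hull, from those of
   the members of [s]. *)
have /choice [g_ g_P] : forall s : seq G, exists g, forall a, a \in s ->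
    ~ hit_by_translate (translate a W) (translate g W).
  move=> s; have /existsNP [g Hg] := no_s s; exists g => a sa H.
  by apply: Hg; exists a.
pose U (s : seq G) : set (borel (closed_subset G)) :=
  [set A | hull L A /\ exists2 a, a \in s & hitting (translate a W) A].
have mhit g : measurable (hitting (translate g W) : set (borel (closed_subset G))).
  by apply: measurable_hitting; exact: open_translate.
have hit_hull g : nu (hull L `&` hitting (translate g W)) = nu (hitting W).
  rewrite -(W_inv g); apply/eqP; rewrite eq_le; apply/andP; split.
    by apply: le_measure; rewrite ?inE//; exact: measurableI.
  apply: (@le_trans _ _ (nu ((hull L `&` hitting (translate g W)) `|` ~` hull L))).
    apply: le_measure; rewrite ?inE//.
      by apply: measurableU; [exact: measurableI|exact: measurableC].
    by move=> A gA; have [LA|nLA] := pselect (hull L A); [left|right].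
  apply: (le_trans (measureU2 _ _ _)); first exact: measurableI.
    exact: measurableC.
  rewrite [X in _ + X](probability_setC nu measurable_hull) hull1 subee//.
  by rewrite adde0.
have US g s : U (g :: s) = (hull L `&` hitting (translate g W)) `|` U s.
  apply/seteqP; split=> A.
    move=> [LA [a]]; rewrite inE => /orP[/eqP ->|sa] aA; first by left.
    by right; split => //; exists a.
  move=> [[LA gA]|[LA [a sa aA]]]; split => //.
    by exists g; rewrite // mem_head.
  by exists a => //; rewrite inE sa orbT.
have H n : exists s, measurable (U s) /\ nu (U s) = nu (hitting W) *+ n.
  elim: n => [|n [s [mU IHs]]].
    exists [::]; rewrite (_ : U _ = set0) ?measure0//.
    by apply/seteqP; split => // A [_ []].
  exists (g_ s :: s); rewrite US; split; first by apply: measurableU => //; exact: measurableI.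
  have disj : (hull L `&` hitting (translate (g_ s) W)) `&` U s = set0.
    apply/seteqP; split => // A [[LA gA] [_ [a sa aA]]].
    apply: (g_P s a sa); apply: hull_hitting LA aA gA => //; exact: open_translate.
  have -> : nu ((hull L `&` hitting (translate (g_ s) W)) `|` U s) =
      nu (hull L `&` hitting (translate (g_ s) W)) + nu (U s).
    by apply: measureU => //; exact: measurableI.
  by rewrite hit_hull IHs -muleS.
have Wfin : nu (hitting W) \is a fin_num.
  by apply: fin_num_measure; exact: measurable_hitting.
pose c := fine (nu (hitting W)).
have c0 : (0 < c)%R by rewrite fine_gt0// W0 ltey_eq Wfin.
(* More than [1 / c] disjoint sets of measure [c] do not fit into a total mass of 1. *)
have [s [mU nuU]] := H (Num.truncn c^-1).+1.
have : nu (U s) <= 1 by exact: probability_le1.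
rewrite nuU -(fineK Wfin) -/c -EFin_natmul lee_fin -mulr_natl.
rewrite -ler_pdivlMr// div1r leNgt truncnS_gt//.
Qed.

End hull_recurrence.

Section approximate_lattices.
Context {R : realType} {G : topologicalGroupType} {d : G -> G -> R}.
Context (d_compat : compatible_metric d) (d_linv : left_invariant_metric d).
Local Open Scope ring_scope.

(** The non-empty closed sets are the countable union of the hitting sets of the balls of radius
    [n], which cannot all be null. The same union shows that the singleton of the empty set is
    measurable. *)
Lemma hitting_ball_gt0 (nu : probability (borel (closed_subset G)) R) :
  nu [set closed_empty G] = 0%E ->
  exists r : R, (0 < nu (hitting [set x | (d 1%g x < r)%R]))%E.
Proof.
move=> nu0; apply: contrapT => /forallNP H.
have E : ~` [set closed_empty G] = \bigcup_n (hitting [set x | d 1%g x < n%:R]).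
  apply/seteqP; split => [A A0|A [n _ [x [Ax _]]] A0]; last by rewrite A0 in Ax.
  have [x Ax] : carrier A !=set0.
    apply/set0P/negP => /eqP A0'; apply: A0.
    case: A A0' => A Ac /= A0'; rewrite /closed_empty; subst A.
    by congr ClosedSubset; exact: Prop_irrelevance.
  exists (Num.truncn (d 1%g x)).+1 => //; exists x; split => //=.
  exact: truncnS_gt.
have m_ n : measurable
    (hitting [set x | d 1%g x < n%:R] : set (borel (closed_subset G))).
  by apply: measurable_hitting; exact: open_metric_ball.
have mE : measurable (~` [set closed_empty G] : set (borel (closed_subset G))).
  by rewrite E; exact: bigcup_measurable.
have mE' : measurable ([set closed_empty G] : set (borel (closed_subset G))).
  by rewrite -[X in measurable X]setCK; exact: measurableC.
have : (nu (~` [set closed_empty G]) <= 0)%E.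
  rewrite E; apply: (le_trans (generalized_Boole_inequality nu m_ _)).
    by rewrite -E.
  rewrite eseries0// => n _ _; apply/eqP; rewrite -measure_le0 leNgt; apply/negP.
  exact: H.
by rewrite [X in (X <= _)%E](probability_setC nu mE') nu0 sube0 lee_fin ler10.
Qed.

Lemma stationary_relatively_dense (L : set G) (mu : probability (borel G) R)
    (nu : probability (borel (closed_subset G)) R) :
  @second_countable G -> nilpotent_group G -> approximate_subgroup L ->
  quasi_invariant mu -> nu (hull L) = 1%E -> stationary mu nu ->
  nu [set closed_empty G] = 0%E -> relatively_dense d L.
Proof.
move=> G2 nilG Lapp mu_quasi hull1 nu_stat nu0.
have [r r_gt0] := hitting_ball_gt0 nu0.
have Wo : open [set x | d 1%g x < r] by exact: open_metric_ball.
have [s sP] := hull_recurrence hull1 Wo r_gt0 (hitting_constant G2 nu_stat mu_quasi nilG Wo).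
have LV x : L x -> L (x^-1)%g.
  by case: Lapp => LV _ _ Lx; rewrite -LV; exists x.
pose r' := \sum_(a <- s) d 1%g a + r.
apply: (nilpotent_relatively_dense d_compat d_linv nilG Lapp (r := r')) => g.
(* Here [h x = a u] and [h y = g v]; eliminating [h] gives [g = (a u) x^-1 y v^-1], whose outer
   factors are bounded by [r']. *)
have [a sa [h [[_ [[x Lx <-] [u ur ax]]] [_ [[y Ly <-] [v vr gy]]]]]] := sP g.
have sum_ge0 t : 0 <= \sum_(i <- t) d 1%g i.
  by apply: sumr_ge0 => i _; exact: metric_ge0.
have ar : d 1%g a <= \sum_(i <- s) d 1%g i.
  by rewrite (big_rem a)//= lerDl.
exists (a * u)%g, (x^-1)%g, y, (v^-1)%g; split.
- by rewrite /r' /= in ur *; have := metric1M d_compat d_linv a u; lra.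
- by rewrite metric1V// /r'; rewrite /= in vr; have := sum_ge0 s; lra.
- exact: LV.
- exact: Ly.
- by rewrite ax mulgK -gy mulgK.
Qed.

End approximate_lattices.

(** * Haar measure from covering numbers *)

(** By compactness of [[0, M]] the values cluster at some point, and a cluster point of an
    ultrafilter is a limit. *)
Lemma ultra_bounded_cvg (R : realType) (T : Type) (U : set_system T)
    (u : T -> R) (M : R) :
  UltraFilter U -> (forall t, 0 <= u t <= M)%R -> cvg (u @ U).
Proof.
move=> UU uM; have FU := @ultra_proper _ _ UU.
have [|p [_ clp]] := @segment_compact R 0%R M (u @ U) _.
  apply: (@filterE _ U) => t /=; rewrite in_itv /=; exact: uM.
apply/cvg_ex; exists p => V pV.
have [//|UV] := in_ultra_setVsetC (u @^-1` V) UU.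
by have [x []] := clp (~` V) V UV pV.
Qed.

Section covering_numbers.
Context {R : realType} {G : topologicalGroupType} {d : G -> G -> R}.
Context (d_compat : compatible_metric d) (d_linv : left_invariant_metric d)
  (d_proper : proper_metric d).
Local Open Scope ring_scope.

Definition metric_ball (x : G) (r : R) : set G := [set y | d x y < r].

Definition metric_bounded (A : set G) : Prop :=
  exists r : R, forall x, A x -> d 1%g x < r.

Definition covered (A : set G) (r : R) (n : nat) : Prop :=
  exists2 s : seq G, (size s <= n)%N &
    forall x, A x -> exists2 a, a \in s & d a x < r.

(* Junk value [0] when [A] has no finite cover by balls of radius [r]. *)
Definition covering_number (A : set G) (r : R) : nat :=
  if pselect (exists n, `[< covered A r n >]) is left ex then ex_minn ex else 0%N.

Lemma metric_boundedS (A B : set G) :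
  A `<=` B -> metric_bounded B -> metric_bounded A.
Proof. by move=> AB [r Br]; exists r => x /AB; exact: Br. Qed.

Lemma metric_boundedU (A B : set G) :
  metric_bounded A -> metric_bounded B -> metric_bounded (A `|` B).
Proof.
move=> [r Ar] [s Bs]; exists (Num.max r s) => x [/Ar|/Bs] xr; rewrite lt_max xr ?orbT//.
Qed.

Lemma metric_bounded_translate (g : G) (A : set G) :
  metric_bounded A -> metric_bounded (translate g A).
Proof.
move=> [r Ar]; exists (d 1%g g + r) => _ [x /Ar xr <-].
by have := metric1M d_compat d_linv g x; lra.
Qed.

Lemma metric_bounded_ball (r : R) : metric_bounded (metric_ball 1%g r).
Proof. by exists r. Qed.

Lemma metric_bounded_covered (A : set G) (r : R) :
  metric_bounded A -> 0 < r -> exists n, covered A r n.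
Proof.
move=> [M AM] r0.
have := @d_proper 1%g M; rewrite compact_cover => /(_ G setT (fun x => metric_ball x r)).
case=> [x _|x _|D _ DA]; first exact: open_metric_ball.
  by exists x => //; rewrite /metric_ball /= metric_refl.
exists (size (finmap.enum_fset D)), (finmap.enum_fset D) => // x /AM xM.
have [|a aD ax] := DA x; first exact: ltW.
by exists a.
Qed.

Lemma covering_numberP (A : set G) (r : R) :
  metric_bounded A -> 0 < r -> covered A r (covering_number A r).
Proof.
move=> Ab r0; rewrite /covering_number; case: pselect => [ex|]; last first.
  by have [n An] := metric_bounded_covered Ab r0; case; exists n; exact/asboolP.
by case: ex_minnP => n /asboolP.
Qed.

Lemma covering_number_le (A : set G) (r : R) (n : nat) :
  covered A r n -> (covering_number A r <= n)%N.
Proof.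
move=> /asboolP An; rewrite /covering_number; case: pselect => // ex.
by case: ex_minnP => m _; exact.
Qed.

Lemma covering_numberS (A B : set G) (r : R) : metric_bounded B -> 0 < r ->
  A `<=` B -> (covering_number A r <= covering_number B r)%N.
Proof.
move=> Bb r0 AB; apply: covering_number_le.
have [s sn Bs] := covering_numberP Bb r0.
by exists s => // x /AB; exact: Bs.
Qed.

Lemma covering_number_translate_le (g : G) (A : set G) (r : R) :
  metric_bounded A -> 0 < r ->
  (covering_number (translate g A) r <= covering_number A r)%N.
Proof.
move=> Ab r0; apply: covering_number_le.
have [s sn As] := covering_numberP Ab r0.
exists [seq (g * a)%g | a <- s]; first by rewrite size_map.
move=> _ [x /As [a sa ax] <-]; exists (g * a)%g; first exact: map_f.
by rewrite d_linv.
Qed.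

Lemma covering_numberU (A B : set G) (r : R) :
  metric_bounded A -> metric_bounded B -> 0 < r ->
  (covering_number (A `|` B) r <= covering_number A r + covering_number B r)%N.
Proof.
move=> Ab Bb r0; apply: covering_number_le.
have [s sn As] := covering_numberP Ab r0.
have [t tn Bt] := covering_numberP Bb r0.
exists (s ++ t); first by rewrite size_cat leq_add.
by move=> x [/As|/Bt] [a sa ax]; exists a; rewrite // mem_cat sa ?orbT.
Qed.

Definition separated (A B : set G) : Prop :=
  exists2 e : R, 0 < e & forall a b, A a -> B b -> e <= d a b.

(** When [r + r <= e], no ball of radius [r] meets both sets, so in an optimal cover of the union
    the balls meeting [A] and those meeting [B] form disjoint families. *)
Lemma covering_number_separated (A B : set G) (e r : R) :
  metric_bounded A -> metric_bounded B -> 0 < r -> r + r <= e ->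
  (forall a b, A a -> B b -> e <= d a b) ->
  (covering_number A r + covering_number B r <= covering_number (A `|` B) r)%N.
Proof.
move=> Ab Bb r0 re ABe.
have [s sn ABs] := covering_numberP (metric_boundedU Ab Bb) r0.
pose meets (C : set G) := fun a : G => `[< exists2 x, C x & d a x < r >].
have coveredI C : C `<=` A `|` B -> covered C r (count (meets C) s).
  move=> CAB; exists [seq a <- s | meets C a]; first by rewrite size_filter.
  move=> x Cx; have [a sa ax] := ABs x (CAB x Cx).
  by exists a => //; rewrite mem_filter sa andbT; apply/asboolP; exists x.
have disj : count (predI (meets A) (meets B)) s = 0%N.
  apply/eqP; rewrite -leqn0 leqNgt -has_count; apply/hasP => -[a _ /=].
  move=> /andP[/asboolP[x Ax ax] /asboolP[y By ay]].
  have := metric_triangle d_compat a x y; rewrite (metric_sym d_compat x a).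
  by have := ABe _ _ Ax By; lra.
apply: leq_trans sn; apply: (@leq_trans (count (meets A) s + count (meets B) s)).
  apply: leq_add; apply: covering_number_le; apply: coveredI; [exact: subsetUl|exact: subsetUr].
by rewrite -count_predUI disj addn0; exact: count_size.
Qed.

(** Cover [A] by [k] unit balls and each of these by a translate of an optimal cover of the unit
    ball. As [k] does not depend on [r], the normalised ratios stay bounded. *)
Lemma covering_number_ratio (A : set G) : metric_bounded A ->
  exists k : nat, forall r, 0 < r ->
    (covering_number A r <= k * covering_number (metric_ball 1%g 1%R) r)%N.
Proof.
move=> Ab; have [k [s sk As]] := metric_bounded_covered Ab ltr01.
exists k => r r0; apply: covering_number_le.
have [t tn Bt] := covering_numberP (metric_bounded_ball 1) r0.
exists [seq (a * b)%g | a <- s, b <- t].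
  by rewrite size_allpairs leq_mul.
move=> x /As [a sa ax]; have [|b tb bx] := Bt (a^-1 * x)%g.
  by rewrite /metric_ball /= -(d_linv a) mulg1 mulVKg.
exists (a * b)%g; first exact: allpairs_f.
by rewrite -[x](mulVKg a) d_linv.
Qed.

Lemma covering_number_ball_gt0 (r : R) : 0 < r ->
  (0 < covering_number (metric_ball 1%g 1%R) r)%N.
Proof.
move=> r0; have [[|a s]//= sn Bs] := covering_numberP (metric_bounded_ball 1) r0.
  have [|//] := Bs 1%g; by rewrite /metric_ball /= metric_refl.
exact: leq_trans sn.
Qed.

(* The ratios of covering numbers at scale [1/(n+1)], normalised at the unit
   ball, converge along an ultrafilter. *)
Lemma exists_metric_content : exists lam : set G -> R,
  [/\ lam (metric_ball 1%g 1%R) = 1,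
      forall A B, metric_bounded B -> A `<=` B -> lam A <= lam B,
      forall A B, metric_bounded A -> metric_bounded B ->
        lam (A `|` B) <= lam A + lam B,
      forall A B, metric_bounded A -> metric_bounded B -> separated A B ->
        lam A + lam B <= lam (A `|` B) &
      forall g A, metric_bounded A -> lam (translate g A) <= lam A].
Proof.
have [U [UU U_oo]] := @ultraFilterLemma _ \oo _.
have FU := @ultra_proper _ _ UU.
pose rad (n : nat) : R := n.+1%:R^-1.
have rad0 n : 0 < rad n by rewrite invr_gt0.
pose B1 := metric_ball 1%g 1%R.
pose q A n : R := (covering_number A (rad n))%:R / (covering_number B1 (rad n))%:R.
have B10 n : 0 < (covering_number B1 (rad n))%:R :> R.
  by rewrite ltr0n covering_number_ball_gt0.
have qcvg A : metric_bounded A -> cvg (q A @ U).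
  move=> /covering_number_ratio [k Ak].
  apply: (@ultra_bounded_cvg _ _ _ _ k%:R) => n.
  by rewrite divr_ge0//= ler_pdivrMr// -natrM ler_nat Ak.
have qD A B n : (q A + q B) n =
    (covering_number A (rad n) + covering_number B (rad n))%:R /
      (covering_number B1 (rad n))%:R.
  by rewrite natrD mulrDl.
have q_le A B : metric_bounded A -> metric_bounded B ->
    (forall n, (covering_number A (rad n) <= covering_number B (rad n))%N) ->
    lim (q A @ U) <= lim (q B @ U).
  move=> Ab Bb AB; apply: ler_lim; [exact: qcvg|exact: qcvg|].
  by apply: filterE => n; rewrite ler_pM2r ?invr_gt0// ler_nat.
exists (fun A => lim (q A @ U)); split.
- rewrite (_ : q _ = cst 1); first by rewrite lim_cst.
  by apply/funext => n; rewrite /q divff// gt_eqF.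
- move=> A B Bb AB; apply: q_le => //; first exact: metric_boundedS Bb.
  by move=> n; exact: covering_numberS.
- move=> A B Ab Bb; have ABb := metric_boundedU Ab Bb.
  rewrite -limD; [|exact: qcvg|exact: qcvg].
  apply: ler_lim; [exact: qcvg|by apply: is_cvgD; exact: qcvg|].
  apply: filterE => n /=; rewrite [leRHS]qD ler_pM2r ?invr_gt0// ler_nat.
  exact: covering_numberU.
- move=> A B Ab Bb [e e0 ABe]; have ABb := metric_boundedU Ab Bb.
  rewrite -limD; [|exact: qcvg|exact: qcvg].
  apply: ler_lim; [by apply: is_cvgD; exact: qcvg|exact: qcvg|].
  (* From this index on [2 rad n <= e], so [covering_number_separated] applies; the ultrafilter
     refines [\oo], so an eventual inequality suffices. *)
  apply: U_oo; exists (Num.truncn (2 / e)) => // n /= en.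
  rewrite [leLHS]qD ler_pM2r ?invr_gt0// ler_nat.
  apply: covering_number_separated ABe => //.
  suff : rad n <= e / 2 by lra.
  rewrite /rad -[leRHS]invrK invf_div lef_pV2 ?posrE ?ltr0n ?divr_gt0//.
  by apply/ltW/(lt_le_trans (truncnS_gt _)); rewrite ler_nat ltnS.
- move=> g A Ab; apply: q_le => //; first exact: metric_bounded_translate.
  by move=> n; exact: covering_number_translate_le.
Qed.

End covering_numbers.

(** * From a content on bounded sets to an invariant Borel measure *)

Section haar_measure.
Context {R : realType} {G : topologicalGroupType} {d : G -> G -> R}.
Context (d_compat : compatible_metric d) (d_linv : left_invariant_metric d)
  (d_proper : proper_metric d).
Context (lam : set G -> R).
Local Open Scope ring_scope.
Local Open Scope ereal_scope.

Notation metric_bounded := (metric_bounded (d := d)).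

Context (lam1 : lam (metric_ball (d := d) 1%g 1%R) = 1%R)
  (lamS : forall A B, metric_bounded B -> A `<=` B -> (lam A <= lam B)%R)
  (lamU : forall A B, metric_bounded A -> metric_bounded B ->
    (lam (A `|` B) <= lam A + lam B)%R)
  (lam_sep : forall A B, metric_bounded A -> metric_bounded B ->
    separated (d := d) A B -> (lam A + lam B <= lam (A `|` B))%R)
  (lam_translate : forall g A, metric_bounded A -> (lam (translate g A) <= lam A)%R).

Let bounded0 : metric_bounded set0.
Proof. by exists 0%R. Qed.

Let lam0 : lam set0 = 0%R.
Proof.
have : (lam (set0 `|` set0) <= lam set0 + lam set0)%R by exact: lamU.
have : (lam set0 + lam set0 <= lam (set0 `|` set0))%R.
  by apply: lam_sep => //; exists 1%R.
by rewrite setU0; lra.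
Qed.

(** These sets take the place of the compact subsets of [U] in the usual passage from a content to
    an outer measure. The uniform margin [e] supplies the distance that [lam_sep] asks for. *)
Definition well_inside (U A : set G) : Prop :=
  metric_bounded A /\
  exists2 e : R, (0 < e)%R & forall a x, A a -> (d a x < e)%R -> U x.

Definition inner_content (U : set G) : \bar R :=
  ereal_sup [set (lam A)%:E | A in well_inside U].

Definition outer_content (X : set G) : \bar R :=
  ereal_inf [set inner_content U | U in [set U | open U /\ X `<=` U]].

Let lam_le_inner A U : well_inside U A -> (lam A)%:E <= inner_content U.
Proof. by move=> UA; apply: ereal_sup_ubound; exists A. Qed.

Let inner_le U (x : \bar R) :
  (forall A, well_inside U A -> (lam A)%:E <= x) -> inner_content U <= x.
Proof. by move=> H; apply: ge_ereal_sup => _ [A UA <-]; exact: H. Qed.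

Let well_inside_sub U A : well_inside U A -> A `<=` U.
Proof. by move=> [_ [e e0 H]] a Aa; apply: (H a a Aa); rewrite metric_refl. Qed.

Let inner_ge0 U : 0 <= inner_content U.
Proof.
apply: (@le_trans _ _ (lam set0)%:E); first by rewrite lam0.
by apply: lam_le_inner; split => //; exists 1%R.
Qed.

(* A Lebesgue number argument: the sets of points whose [1/(k+1)]-ball lies in
   one of the first [k] members increase to the union. *)
Let well_inside_bigcup (U : nat -> set G) A : (forall n, open (U n)) ->
  well_inside (\bigcup_n U n) A ->
  exists k, forall a, A a -> exists2 i, (i < k)%N &
    forall x, (d a x < k.+1%:R^-1)%R -> U i x.
Proof.
move=> Uo [[M AM] [e e0 He]].
pose V k : set G := [set a | exists2 i, (i < k)%N &
  forall x, (d a x < k.+1%:R^-1)%R -> U i x].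
have VS k l : (k <= l)%N -> V k `<=` V l.
  move=> kl a [i ik H]; exists i; first exact: leq_trans kl.
  move=> x /lt_le_trans ax; apply: H; apply: ax.
  by rewrite lef_pV2 ?posrE ?ltr0n// ler_nat ltnS.
(* The compact set is a closed ball containing [A], which itself need not be closed; the complement
   of [closure A] takes care of the rest of the ball. *)
pose W k := interior (V k) `|` ~` closure A.
have := @d_proper 1%g M; rewrite compact_cover => /(_ nat setT W).
case=> [k _|x _|D _ DA].
- by apply: openU; [exact: open_interior|apply: closed_openC; exact: closed_closure].
- have [xA|xA] := pselect (closure A x); last by exists 0%N => //; right.
  have [_ _ _ d_nbhs] := d_compat.
  have /xA [a [Aa /= xa]] : nbhs x (metric_ball (d := d) x e).
    by apply/d_nbhs; exists e.
  have [i _ Ux] : (\bigcup_n U n) x by apply: He Aa _; rewrite metric_sym.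
  have /d_nbhs [r r0 rU] : nbhs x (U i) by exact: open_nbhs_nbhs.
  (* For [y] within [r / 2] of [x], the ball of radius [1/(k+1) <= r / 2] about [y] stays in the
     [r]-ball about [x], hence in [U i]; moreover [i < k]. *)
  pose k := maxn i.+1 (Num.truncn (2 / r)).
  exists k => //; left; apply/d_nbhs; exists (r / 2)%R; first by rewrite divr_gt0.
  move=> y /= xy; exists i; first exact: leq_maxl.
  move=> z yz; apply: rU => /=.
  have kr : (k.+1%:R^-1 <= r / 2)%R.
    rewrite -[leRHS]invrK invf_div lef_pV2 ?posrE ?ltr0n ?divr_gt0//.
    apply/ltW/(lt_le_trans (truncnS_gt _)); rewrite ler_nat ltnS.
    exact: leq_maxr.
  by have := metric_triangle d_compat y x z; have := lt_le_trans yz kr; lra.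
- exists (\max_(k <- finmap.enum_fset D) k) => a Aa.
  have [|k kD [|/(_ (subset_closure Aa))//]] := DA a; first by apply/ltW/AM.
  move=> /interior_subset; apply: VS; exact: leq_bigmax_seq.
Qed.

Let lam_bigU (A : nat -> set G) k : (forall i, metric_bounded (A i)) ->
  metric_bounded (\big[setU/set0]_(i < k) A i) /\
  (lam (\big[setU/set0]_(i < k) A i) <= \sum_(i < k) lam (A i))%R.
Proof.
move=> Ab; elim: k => [|k [IHb IH]]; first by rewrite !big_ord0 lam0.
rewrite !big_ord_recr /=; split; first exact: metric_boundedU.
by apply: (le_trans (lamU IHb (Ab k))); rewrite lerD2r.
Qed.

(** A set well inside the union is covered by finitely many pieces, each well inside one [U i] with
    margin [1/(k+1)], and [lam] is finitely subadditive. *)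
Let inner_sigma_subadditive (U : nat -> set G) : (forall n, open (U n)) ->
  inner_content (\bigcup_n U n) <= \sum_(n <oo) inner_content (U n).
Proof.
move=> Uo; apply: inner_le => A UA.
have [k kP] := well_inside_bigcup Uo UA.
pose Ai i := A `&` [set a | forall x, (d a x < k.+1%:R^-1)%R -> U i x].
have Aib i : metric_bounded (Ai i).
  by apply: metric_boundedS (proj1 UA); exact: subIsetl.
have [bb bl] := lam_bigU k Aib.
apply: (@le_trans _ _ (\sum_(i < k) lam (Ai i))%R%:E).
  rewrite lee_fin; apply: le_trans bl; apply: lamS => // a Aa.
  have [i ik H] := kP a Aa; by rewrite -bigcup_mkord; exists i.
rewrite -sumEFin; apply: (@le_trans _ _ (\sum_(i < k) inner_content (U i))).
  apply: lee_sum => i _; apply: lam_le_inner; split => //.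
  by exists (k.+1%:R^-1)%R; [rewrite invr_gt0 ltr0n|move=> a x [_ H]; exact: H].
by rewrite -(big_mkord xpredT (fun i => inner_content (U i))); exact: nneseries_lim_ge.
Qed.

Let outer_le_inner X U : open U -> X `<=` U -> outer_content X <= inner_content U.
Proof. by move=> Uo XU; apply: ereal_inf_lbound; exists U. Qed.

Let le_outer X (x : \bar R) :
  (forall U, open U -> X `<=` U -> x <= inner_content U) -> x <= outer_content X.
Proof. by move=> H; apply: le_ereal_inf_tmp => _ [U [Uo XU] <-]; exact: H. Qed.

Let outer0 : outer_content set0 = 0.
Proof.
apply/eqP; rewrite eq_le; apply/andP; split; last first.
  by apply: le_outer => U _ _; exact: inner_ge0.
apply: (le_trans (outer_le_inner open0 _)) => //.
apply: inner_le => A /well_inside_sub; rewrite subset0 => ->.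
by rewrite lam0.
Qed.

Let outer_ge0 X : 0 <= outer_content X.
Proof. by apply: le_outer => U _ _; exact: inner_ge0. Qed.

Let outerS : {homo outer_content : A B / A `<=` B >-> A <= B}.
Proof.
move=> X Y XY; apply: le_outer => U Uo YU.
by apply: outer_le_inner => //; exact: subset_trans YU.
Qed.

Let outer_sigma_subadditive : sigma_subadditive outer_content.
Proof.
move=> A; have [[i ioo]|] := pselect (exists i, outer_content (A i) = +oo).
  by rewrite (eseries_pinfty _ _ ioo) ?leey// => n _; rewrite -ltNye (lt_le_trans _ (outer_ge0 _)).
rewrite -forallNE => Aoo; apply/lee_addgt0Pr => e e0.
apply: le_trans (epsilon_trick _ _ (ltW e0)); last by move=> n; exact: outer_ge0.
have /choice [U UP] : forall n, exists U, [/\ open U, A n `<=` U &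
    inner_content U <= outer_content (A n) + (e / (2 ^ n.+1)%:R)%:E].
  move=> n; have en : (0 < e / (2 ^ n.+1)%:R)%R by rewrite divr_gt0// ltr0n expn_gt0.
  have An : outer_content (A n) \is a fin_num.
    by rewrite ge0_fin_numE// ltey; apply/eqP; exact: Aoo.
  have [_ [U [Uo AU] <-] /ltW UA] := lb_ereal_inf_adherent en An.
  by exists U.
apply: (@le_trans _ _ (inner_content (\bigcup_n U n))).
  apply: outer_le_inner; first by apply: bigcup_open => n _; case: (UP n).
  by apply: subset_bigcup => n _; case: (UP n).
apply: (le_trans (inner_sigma_subadditive _)); first by move=> n; case: (UP n).
by apply: lee_nneseries => [n *|n _]; [exact: inner_ge0|case: (UP n)].
Qed.

HB.instance Definition _ := isOuterMeasure.Build R G outer_content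
  outer0 outer_ge0 outerS outer_sigma_subadditive.

(** For an open test set [O], take [A] well inside the intersection of [O] and [U], then [B] well
    inside [O] minus [closure A]. They are separated, so [lam A + lam B] is at most the inner
    content of [O]; suprema over [B] and then over [A] give Caratheodory's inequality. *)
Let open_caratheodory (U : set G) : open U -> outer_content.-caratheodory U.
Proof.
move=> Uo; apply: le_caratheodory_measurable => X.
apply: le_outer => O Oo XO.
apply: (@le_trans _ _ (inner_content (O `&` U) + outer_content (O `&` ~` U))).
  apply: leeD; last by apply: outerS => x [Xx Ux]; split => //; exact: XO.
  by apply: outer_le_inner; [exact: openI|move=> x [Xx Ux]; split => //; exact: XO].
have [->|Ofin] := eqVneq (inner_content O) +oo; first exact: leey.
have {}Ofin : inner_content O \is a fin_num by rewrite ge0_fin_numE// ltey.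
have O'fin : outer_content (O `&` ~` U) \is a fin_num.
  rewrite ge0_fin_numE//; apply: le_lt_trans (_ : inner_content O < +oo).
    by apply: outer_le_inner => // x [].
  by rewrite ltey_eq Ofin.
(* The suprema are taken one at a time by moving the other summand across, whence the two finiteness
   facts above. *)
rewrite -leeBrDr//; apply: inner_le => A OUA.
rewrite leeBrDr// addrC -leeBrDr//.
have [Ab [e e0 He]] := OUA.
(* By the margin [e], [closure A] lies in [U], so [V] contains [O] minus [U]. *)
pose V := O `&` ~` closure A.
apply: (@le_trans _ _ (inner_content V)).
  apply: outer_le_inner.
    by apply: openI => //; apply: closed_openC; exact: closed_closure.
  move=> x [Ox Ux]; split => // xA; apply: Ux.
  have [_ _ _ d_nbhs] := d_compat.
  have /xA [a [Aa /= xa]] : nbhs x (metric_ball (d := d) x e).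
    by apply/d_nbhs; exists e.
  by have [] := He a x Aa; rewrite // metric_sym.
apply: inner_le => B VB; have [Bb [r r0 Hr]] := VB.
rewrite leeBrDr// -EFinD.
apply: (@le_trans _ _ (lam (B `|` A))%:E).
  rewrite lee_fin; apply: lam_sep => //; exists r => // b a Bb' Aa.
  rewrite leNgt; apply/negP => ba; have [_] := Hr b a Bb' ba; apply.
  exact: subset_closure.
apply: lam_le_inner; split; first exact: metric_boundedU.
exists (Num.min e r) => [|a x]; first by rewrite lt_min e0.
rewrite lt_min => -[Ba|Aa] /andP[ae ar].
  by have [] := Hr _ _ Ba ar.
by have [] := He _ _ Aa ae.
Qed.

Let inner_translate_le g U : inner_content (translate g U) <= inner_content U.
Proof.
apply: inner_le => A [Ab [e e0 He]].
have -> : A = translate g (translate (g^-1)%g A).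
  by rewrite translateM mulgV; apply/funext => x; rewrite translateE /= invg1 mul1g.
have gAb : metric_bounded (translate (g^-1)%g A) by exact: metric_bounded_translate.
apply: (@le_trans _ _ (lam (translate (g^-1)%g A))%:E).
  by rewrite lee_fin; exact: lam_translate.
apply: lam_le_inner; split => //; exists e => // _ x [a Aa <-] ax.
have : translate g U (g * x)%g.
  by apply: He Aa _; rewrite -(d_linv (g^-1)%g) mulKg.
by rewrite translateE /= mulKg.
Qed.

Let outer_translate_le g X : outer_content (translate g X) <= outer_content X.
Proof.
apply: le_outer => U Uo XU.
apply: le_trans (inner_translate_le g U); apply: outer_le_inner.
  exact: open_translate.
by move=> _ [x Xx <-]; exists x => //; exact: XU.
Qed.

Let haar (E : set (borel G)) : \bar R := outer_content E.

Let borel_caratheodory (E : set (borel G)) :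
  measurable E -> outer_content.-caratheodory E.
Proof.
apply: (@smallest_sub _ _ _ outer_content.-caratheodory); last exact: open_caratheodory.
split; first exact: caratheodory_measurable_set0.
- by move=> A mA; rewrite setTD; exact: caratheodory_measurable_setC.
- exact: caratheodory_measurable_bigcup.
Qed.

Let haar0 : haar set0 = 0. Proof. exact: outer0. Qed.
Let haar_ge0 E : 0 <= haar E. Proof. exact: outer_ge0. Qed.
Let haar_sigma_additive : semi_sigma_additive haar.
Proof.
move=> F mF tF mUF.
apply: (@caratheodory_measure_sigma_additive R G outer_content) => //.
  by move=> n; exact: borel_caratheodory.
exact: borel_caratheodory.
Qed.

HB.instance Definition _ := isMeasure.Build _ (borel G) R haar
  haar0 haar_ge0 haar_sigma_additive.

Lemma content_haar_measure :
  exists m : {measure set (borel G) -> \bar R}, haar_measure m.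
Proof.
exists (haar : {measure set (borel G) -> \bar R}); split.
(* An open set containing the whole group has the unit ball well inside it, so the total mass is at
   least 1. *)
- rewrite gt_eqF//; apply: (@lt_le_trans _ _ 1); first exact: lte01.
  apply: le_outer => U _ TU; rewrite -lam1; apply: lam_le_inner.
  split; first exact: metric_bounded_ball.
  by exists 1%R => // a x _ _; exact: TU.
- move=> K; rewrite compact_cover => /(_ nat setT (fun n => metric_ball (d := d) 1%g n%:R)).
  case=> [n _|x _|D _ DK]; first exact: open_metric_ball.
    by exists (Num.truncn (d 1%g x)).+1 => //; exact: truncnS_gt.
  pose B := metric_ball (d := d) 1%g (\max_(n <- finmap.enum_fset D) n)%:R.
  apply: (@le_lt_trans _ _ (inner_content B)).
    apply: outer_le_inner; first exact: open_metric_ball.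
    move=> x /DK [n nD xn]; apply: lt_le_trans xn _; rewrite ler_nat.
    exact: leq_bigmax_seq.
  apply: (@le_lt_trans _ _ (lam B)%:E); last exact: ltry.
  apply: inner_le => A /well_inside_sub AB; rewrite lee_fin.
  by apply: lamS => //; exact: metric_bounded_ball.
- move=> g E _; apply/eqP; rewrite eq_le; apply/andP; split.
    exact: outer_translate_le.
  apply: le_trans (outer_translate_le (g^-1)%g (translate g E)).
  rewrite translateM mulVg; apply: outerS => x Ex.
  by rewrite translateE /= invg1 mul1g.
Qed.

End haar_measure.

Lemma exists_haar_measure (R : realType) (G : topologicalGroupType)
    (d : G -> G -> R) :
  compatible_metric d -> left_invariant_metric d -> proper_metric d ->
  exists m : {measure set (borel G) -> \bar R}%R, haar_measure m.
Proof.
move=> d_compat d_linv d_proper.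
have [lam [lam1 lamS lamU lam_sep lam_translate]] :=
  exists_metric_content d_compat d_linv d_proper.
exact: (content_haar_measure d_compat d_linv d_proper lam1).
Qed.

(** * An admissible probability with the null sets of Haar measure *)

Section admissible_probability.
Local Open Scope ring_scope.
Local Open Scope ereal_scope.
Context {R : realType} {G : topologicalGroupType} {d : G -> G -> R}.
Context (d_compat : compatible_metric d) (d_linv : left_invariant_metric d)
  (d_proper : proper_metric d) (T2 : hausdorff_space G).
Context (m : {measure set (borel G) -> \bar R}) (m_haar : haar_measure m).

Let ball (r : R) : set (borel G) := metric_ball (d := d) 1%g r.

Let mball r : measurable (ball r).
Proof. by apply: measurable_open; exact: open_metric_ball. Qed.

Let ball_cover : \bigcup_n ball n.+1%:R = setT.
Proof.
apply/seteqP; split => // x _; exists (Num.truncn (d 1%g x)) => //.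
exact: truncnS_gt.
Qed.

Let translate_ball a r : translate a (ball r) = metric_ball (d := d) a r.
Proof.
rewrite translateE; apply/funext => x.
by rewrite /ball /metric_ball /= -(d_linv a) mulg1 mulVKg.
Qed.

Let ball_fin r : m (ball r) < +oo.
Proof.
have cK := @d_proper 1%g r.
have [_ fin _] := m_haar; apply: le_lt_trans (fin _ cK).
apply: le_measure; rewrite ?inE//; last by move=> x; exact: ltW.
rewrite -[X in measurable X]setCK; apply: measurableC; apply: measurable_open.
by apply: closed_openC; exact: compact_closed.
Qed.

Let null_of_bounded (A : set (borel G)) : measurable A ->
  (forall n, m (A `&` ball n.+1%:R) = 0) -> m A = 0.
Proof.
move=> mA A0; apply/eqP; rewrite -measure_le0.
have E : A = \bigcup_n (A `&` ball n.+1%:R).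
  by rewrite -setI_bigcupr ball_cover setIT.
have mAn n : measurable (A `&` ball n.+1%:R) by exact: measurableI.
rewrite {1}E; apply: (le_trans (generalized_Boole_inequality m mAn _)).
  exact: bigcup_measurable.
by rewrite eseries0.
Qed.

(** Finitely many translates of a null ball would cover any larger ball, making every ball null and
    [m] zero. *)
Let ball_gt0 r : (0 < r)%R -> 0 < m (ball r).
Proof.
move=> r0; rewrite lt0e measure_ge0 andbT; apply/eqP => mr0.
have [mT _ m_inv] := m_haar; move/eqP: mT; apply.
apply: null_of_bounded => // n; rewrite setTI.
have [_ [s _ sP]] := metric_bounded_covered d_compat d_proper
  (metric_bounded_ball (d := d) n.+1%:R) r0.
have ms a : measurable (translate a (ball r) : set (borel G)).
  exact: measurable_translate.
have m0 : m (\big[setU/set0]_(a <- s) translate a (ball r)) = 0.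
  elim: s {sP} => [|a s IHs]; first by rewrite big_nil measure0.
  rewrite big_cons; apply/eqP; rewrite -measure_le0.
  have : m (translate a (ball r) `|` \big[setU/set0]_(b <- s) translate b (ball r)) <=
      m (translate a (ball r)) + m (\big[setU/set0]_(b <- s) translate b (ball r)).
    by apply: measureU2 => //; exact: bigsetU_measurable.
  by rewrite IHs adde0 m_inv// mr0.
apply/eqP; rewrite -measure_le0 -m0; apply: le_measure; rewrite ?inE//.
  exact: bigsetU_measurable.
move=> x /sP [a sa ax]; rewrite -bigcup_seq; exists a => //.
by rewrite translate_ball.
Qed.

Let weight_ge0 n : (0 <= (2 ^ n.+1)%:R^-1 / fine (m (ball n.+1%:R)) :> R)%R.
Proof. by rewrite divr_ge0// fine_ge0. Qed.

(** Haar measure may be infinite, so its restrictions to balls are normalised and mixed with weights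
    [2^-(n+1)], which sum to 1. *)
Let weighted (n : nat) : {measure set (borel G) -> \bar R} :=
  mscale (NngNum (weight_ge0 n)) (mrestr m (mball n.+1%:R)).

Let prob : set (borel G) -> \bar R := mseries weighted 0.

HB.instance Definition _ := Measure.on prob.

Let probE A : prob A =
  \sum_(n <oo) ((2 ^ n.+1)%:R^-1 / fine (m (ball n.+1%:R)))%:E * m (A `&` ball n.+1%:R).
Proof. by []. Qed.

Let prob_setT : prob setT = 1.
Proof.
rewrite probE (eq_eseriesr (g := fun n => (1 / (2 ^ (n + 1))%:R)%:E)); last first.
  move=> n _; rewrite setTI addn1 -{2}(@fineK _ (m (ball n.+1%:R))); last first.
    by rewrite ge0_fin_numE.
  rewrite -EFinM mulfVK ?div1r// gt_eqF// fine_gt0// ball_fin andbT.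
  exact: ball_gt0.
by have /cvg_lim := @cvg_geometric_eseries_half R 1 0; rewrite expr0 divr1; apply.
Qed.

HB.instance Definition _ := Measure_isProbability.Build _ (borel G) R prob prob_setT.

(** All weights are positive and the balls exhaust [G], so the mixture keeps the null sets of [m].
    Absolute continuity and quasi-invariance both rest on this. *)
Let prob_null A : measurable A -> prob A = 0 <-> m A = 0.
Proof.
move=> mA; split=> A0.
  apply: null_of_bounded => // n.
  have w0 : (0 < (2 ^ n.+1)%:R^-1 / fine (m (ball n.+1%:R)) :> R)%R.
    rewrite divr_gt0 ?invr_gt0 ?ltr0n ?expn_gt0// fine_gt0// ball_fin andbT.
    exact: ball_gt0.
  have : weighted n A <= prob A.
    rewrite /prob /mseries (@nneseriesD1 _ (fun k => weighted k A) n)//.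
    by rewrite leeDl// nneseries_ge0.
  rewrite A0 measure_le0 /weighted /= /mscale /mrestr /= mule_eq0.
  by rewrite eqe gt_eqF//= => /eqP.
rewrite probE eseries0// => n _ _.
have -> : m (A `&` ball n.+1%:R) = 0; last by rewrite mule0.
apply/eqP; rewrite -measure_le0 -A0.
by apply: le_measure; rewrite ?inE//; exact: measurableI.
Qed.

Lemma haar_admissible_probability :
  exists mu : probability (borel G) R, admissible mu /\ quasi_invariant mu.
Proof.
exists (prob : probability (borel G) R); split; last first.
  move=> g A mA /(prob_null mA) A0; apply/prob_null; first exact: measurable_translate.
  by have [_ _ ->] := m_haar.
split.
  exists m => //; apply/null_content_dominatesP => A mA A0.
  exact/prob_null.
(* Every neighbourhood of a point contains a translate of a ball, of positive measure, so the
   support is already all of [G]. *)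
apply/seteqP; split => // x _; apply: sub_gen_smallest => U Uo Ux.
rewrite lt0e measure_ge0 andbT; apply/eqP.
have mU : measurable (U : set (borel G)) by exact: measurable_open.
move=> /(prob_null mU) U0.
have [_ _ _ d_nbhs] := d_compat.
have /d_nbhs [r r0 rU] : nbhs x U by exact: open_nbhs_nbhs.
have := ball_gt0 r0; rewrite ltNge => /negP; apply.
have [_ _ m_inv] := m_haar; rewrite -(m_inv x)// -U0.
apply: le_measure; rewrite ?inE//; first exact: measurable_translate.
by rewrite (translate_ball x).
Qed.

End admissible_probability.

Theorem theorem1p12 (R : realType) (G : topologicalGroupType)
    (lcscG : lcsc G) (nilG : nilpotent_group G)
    (d : G -> G -> R) (d_compat : compatible_metric d)
    (d_linv : left_invariant_metric d) (d_proper : proper_metric d)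
    (L : set G) :
  approximate_lattice d L -> uniform_approximate_lattice d L.
Proof.
move=> [Lapp Ldisc Lstat]; have [T2 _ G2] := lcscG.
have [m m_haar] := exists_haar_measure d_compat d_linv d_proper.
have [mu [mu_adm mu_quasi]] :=
  haar_admissible_probability d_compat d_linv d_proper T2 m_haar.
have [nu [nu_hull nu_stat nu0]] := Lstat mu mu_adm.
split=> //; split=> //; first by exists 1%g; case: Lapp.
exact: (stationary_relatively_dense d_compat d_linv G2 nilG Lapp mu_quasi nu_hull).
Qed.
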